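(* Let $(x_n)_{n\geq 0}$ be the sequence of integers defined by $x_0=1$ and $$x_n=x_{n-1}+2x_{n-2}+\dots+(n-1)x_1+nx_0=\sum_{i=1}^{n} i\,x_{n-i}$$ for all integers $n\geq 1$. Then the quotient set $R((x_n)_{n\geq 0})$ is dense in $\mathbb{Q}_p$ for all primes $p$.
   Context: For a set of integers $A$, the quotient set (ratio set) of $A$ is $R(A)=\{a/b : a,b\in A,\ b\neq 0\}$; for a sequence $(x_n)_{n\ge 0}$ of integers, its quotient set $R((x_n)_{n\ge0})$ is $R(\{x_n : n\geq 0\})$. $\mathbb{Q}_p$ is the field of $p$-adic numbers, and denseness is with respect to the $p$-adic metric, with $R(A)\subset\mathbb{Q}\subset\mathbb{Q}_p$. *)

(* Defs.v *)
From HB Require Import structures.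
From mathcomp Require Import all_boot all_order all_algebra.
From mathcomp Require Import ring zify.
From mathcomp Require Import boolp classical_sets functions topology.

Set Implicit Arguments.
Unset Strict Implicit.
Unset Printing Implicit Defensive.

Import Order.TTheory GRing.Theory Num.Theory.
Local Open Scope classical_set_scope.
Local Open Scope ring_scope.

Definition padic_val (p : nat) (q : rat) : int :=
  (logn p `|numq q|)%:Z - (logn p `|denq q|)%:Z.

Definition padic_norm (p : nat) (q : rat) : rat :=
  if q == 0 then 0 else p%:R ^ (- padic_val p q).

Section PadicNorm.
Variables (p : nat) (p_pr : prime p).
Local Notation norm := (padic_norm p).

Let p_gt0 : 0 < p%:R :> rat. Proof. by rewrite ltr0n prime_gt0. Qed.
Let p_gt1 : 1 < p%:R :> rat. Proof. by rewrite ltr1n prime_gt1. Qed.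
Let p_neq0 : p%:R != 0 :> rat. Proof. by rewrite gt_eqF. Qed.

Lemma padic_valE (a b : int) : a != 0 -> b != 0 ->
  padic_val p (a%:~R / b%:~R) = (logn p `|a|)%:Z - (logn p `|b|)%:Z.
Proof.
move=> a0 b0; set q : rat := _ / _.
have b0' : b%:~R != 0 :> rat by rewrite intr_eq0.
have d0' : (denq q)%:~R != 0 :> rat by rewrite intr_eq0 denq_neq0.
have e : numq q * b = a * denq q.
  apply: (@intr_inj rat); rewrite !intrM.
  have : (numq q)%:~R / (denq q)%:~R = q by rewrite divq_num_den.
  by rewrite {2}/q => /eqP; rewrite eqr_div// => /eqP.
have q0 : numq q != 0 by rewrite numq_eq0 mulf_neq0 ?invr_eq0 ?intr_eq0.
have := congr1 (fun z : int => logn p `|z|) e.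
rewrite /= !abszM !lognM ?absz_gt0 ?denq_neq0// /padic_val.
lia.
Qed.

Lemma padic_norm_frac (a b : int) : a != 0 -> b != 0 ->
  norm (a%:~R / b%:~R) = p%:R ^ ((logn p `|b|)%:Z - (logn p `|a|)%:Z).
Proof.
move=> a0 b0; rewrite /padic_norm padic_valE// opprB.
by rewrite mulf_eq0 invr_eq0 !intr_eq0 (negPf a0) (negPf b0).
Qed.

Lemma padic_norm0 : norm 0 = 0. Proof. by rewrite /padic_norm eqxx. Qed.

Lemma padic_norm_ge0 x : 0 <= norm x.
Proof. by rewrite /padic_norm; case: eqP => // _; rewrite exprz_ge0// ltW. Qed.

Lemma padic_norm_eq0 x : (norm x == 0) = (x == 0).
Proof.
rewrite /padic_norm; case: (x =P 0) => [|_]; first by rewrite eqxx.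
by apply/negP => /eqP/eqP; rewrite expfz_eq0 (negPf p_neq0) andbF.
Qed.

Lemma padic_normM x y : norm (x * y) = norm x * norm y.
Proof.
have [->|x0] := eqVneq x 0; first by rewrite !(mul0r, padic_norm0).
have [->|y0] := eqVneq y 0; first by rewrite !(mulr0, padic_norm0).
rewrite -(divq_num_den x) -(divq_num_den y) mulf_div -!intrM.
rewrite !padic_norm_frac ?mulf_neq0 ?denq_neq0 ?numq_eq0// -expfzDr//.
rewrite !abszM !lognM ?absz_gt0 ?denq_neq0 ?numq_eq0//.
congr (_ ^ _); lia.
Qed.

Lemma padic_norm1 : norm 1 = 1.
Proof.
have := padic_normM 1 1; rewrite mulr1 => /eqP.
by rewrite -subr_eq0 -{1}(mulr1 (norm 1)) -mulrBr mulf_eq0 padic_norm_eq0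
  oner_eq0 /= subr_eq0 => /eqP.
Qed.

Lemma padic_normN x : norm (- x) = norm x.
Proof. by rewrite /padic_norm oppr_eq0 /padic_val numqN denqN abszN. Qed.

Lemma padic_norm_sym x y : norm (x - y) = norm (y - x).
Proof. by rewrite -padic_normN opprB. Qed.

Lemma padic_normV x : norm x^-1 = (norm x)^-1.
Proof.
have [->|x0] := eqVneq x 0; first by rewrite !(invr0, padic_norm0).
have n0 : norm x != 0 by rewrite padic_norm_eq0.
by apply: (mulfI n0); rewrite -padic_normM !divff// padic_norm1.
Qed.

Lemma padic_normD x y : norm (x + y) <= Num.max (norm x) (norm y).
Proof.
have [->|x0] := eqVneq x 0; first by rewrite add0r le_max lexx orbT.
have [->|y0] := eqVneq y 0; first by rewrite addr0 le_max lexx.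
have [->|s0] := eqVneq (x + y) 0.
  by rewrite padic_norm0 le_max padic_norm_ge0.
pose D : int := denq x * denq y.
pose A : int := numq x * denq y; pose B : int := numq y * denq x.
have D0 : D != 0 by rewrite mulf_neq0 ?denq_neq0.
have dx0 : (denq x)%:~R != 0 :> rat by rewrite intr_eq0 denq_neq0.
have dy0 : (denq y)%:~R != 0 :> rat by rewrite intr_eq0 denq_neq0.
have xE : x = A%:~R / D%:~R.
  by rewrite -{1}(divq_num_den x) !intrM; field; apply/andP.
have yE : y = B%:~R / D%:~R.
  by rewrite -{1}(divq_num_den y) !intrM; field; apply/andP.
have sE : x + y = (A + B)%:~R / D%:~R by rewrite xE yE -mulrDl intrD.
have A0 : A != 0 by rewrite mulf_neq0 ?denq_neq0 ?numq_eq0.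
have B0 : B != 0 by rewrite mulf_neq0 ?denq_neq0 ?numq_eq0.
have S0 : A + B != 0.
  by apply: contraNneq s0 => S0; rewrite sE S0 mul0r.
rewrite sE xE yE !padic_norm_frac// le_max !ler_eXz2l//.
have key m : (m <= logn p `|A|%N)%N -> (m <= logn p `|B|%N)%N ->
    (m <= logn p `|(A + B)%R|%N)%N.
  rewrite -!pfactor_dvdn ?absz_gt0// => hA hB.
  have : (((p ^ m)%N%:Z %| A + B)%Z) by rewrite rpredD// dvdzE.
  by rewrite dvdzE.
have [le|/ltnW le] := leqP (logn p `|A|%N) (logn p `|B|%N).
  by have := key _ (leqnn _) le; lia.
by have := key _ le (leqnn _); lia.
Qed.

Lemma padic_norm_lt e x y : norm x < e -> norm y < e -> norm (x + y) < e.
Proof.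
by move=> hx hy; apply: le_lt_trans (padic_normD _ _) _; rewrite gt_max hx hy.
Qed.

Lemma padic_normB_lt e x y : norm x < e -> norm y < e -> norm (x - y) < e.
Proof. by move=> hx hy; apply: padic_norm_lt; rewrite ?padic_normN. Qed.

Lemma padic_norm_dom x y : norm (x - y) < norm y -> norm x = norm y.
Proof.
move=> h; apply/eqP; rewrite eq_le; apply/andP; split.
  by rewrite -(subrK y x); apply: le_trans (padic_normD _ _) _; rewrite ge_max lexx ltW.
rewrite leNgt; apply/negP => lt; have := padic_normB_lt lt h.
by rewrite opprB addrC subrK ltxx.
Qed.

End PadicNorm.

(* The field of p-adic numbers is the completion of the rationals for the
   p-adic norm: p-adic Cauchy sequences modulo p-adic null sequences.  The
   primality proof is an argument of the predicates below only so that the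
   algebraic instances, which need it, can be inferred. *)
Definition padic_cauchy (p : nat) (p_pr : prime p) : {pred (nat -> rat)} :=
  fun x => `[< forall e : rat, 0 < e -> exists N, forall m n,
    (N <= m)%N -> (N <= n)%N -> padic_norm p (x m - x n) < e >].
Arguments padic_cauchy {p} p_pr _ : simpl never.

Section Cauchy.
Variables (p : nat) (p_pr : prime p).
Local Notation norm := (padic_norm p).

Lemma padic_cauchyP (x : nat -> rat) : reflect
  (forall e : rat, 0 < e -> exists N, forall m n,
    (N <= m)%N -> (N <= n)%N -> norm (x m - x n) < e)
  (x \in padic_cauchy p_pr).
Proof. exact: asboolP. Qed.

Lemma padic_cauchy_bounded (x : nat -> rat) : x \in padic_cauchy p_pr ->
  exists2 M, 0 < M & exists N, forall n, (N <= n)%N -> norm (x n) < M.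
Proof.
move=> /padic_cauchyP/(_ 1 ltr01)[N hN].
exists (Num.max 1 (norm (x N) + 1)); first by rewrite lt_max ltr01.
exists N => n Nn; rewrite -(subrK (x N) (x n)); apply: padic_norm_lt => //.
  by rewrite lt_max hN.
by rewrite lt_max ltrDl ltr01 orbT.
Qed.

Lemma padic_cauchy_subring : subring_closed (padic_cauchy p_pr).
Proof.
split=> [|x y|x y].
- by apply/padic_cauchyP => e e0; exists 0 => m n _ _; rewrite subrr padic_norm0.
- move=> /padic_cauchyP hx /padic_cauchyP hy; apply/padic_cauchyP => e e0.
  have [N hN] := hx e e0; have [N' hN'] := hy e e0.
  exists (maxn N N') => m n; rewrite !geq_max => /andP[m1 m2] /andP[n1 n2].
  have -> : (x - y) m - (x - y) n = (x m - x n) - (y m - y n).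
    by change ((x m - y m) - (x n - y n) = (x m - x n) - (y m - y n)); ring.
  by apply: padic_normB_lt; [|exact: hN|exact: hN'].
- move=> cx cy; have [M M0 [K hK]] := padic_cauchy_bounded cx.
  have [M' M'0 [K' hK']] := padic_cauchy_bounded cy.
  move: cx cy => /padic_cauchyP hx /padic_cauchyP hy.
  apply/padic_cauchyP => e e0.
  have [N hN] := hx (e / M') (divr_gt0 e0 M'0).
  have [N' hN'] := hy (e / M) (divr_gt0 e0 M0).
  exists (maxn (maxn N N') (maxn K K')) => m n; rewrite !geq_max.
  move=> /andP[/andP[m1 m2] /andP[m3 m4]] /andP[/andP[n1 n2] /andP[n3 n4]].
  have -> : (x * y) m - (x * y) n = x m * (y m - y n) + (x m - x n) * y n.
    by change (x m * y m - x n * y n = x m * (y m - y n) + (x m - x n) * y n);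
      ring.
  apply: padic_norm_lt => //; rewrite padic_normM//.
    rewrite -[e](divfK (lt0r_neq0 M0)) mulrC.
    by apply: ltr_pM; rewrite ?padic_norm_ge0// ?hN' ?hK.
  rewrite -[e](divfK (lt0r_neq0 M'0)).
  by apply: ltr_pM; rewrite ?padic_norm_ge0// ?hN ?hK'.
Qed.

HB.instance Definition _ := GRing.isSubringClosed.Build (nat -> rat)
  (padic_cauchy p_pr) padic_cauchy_subring.

Record cauchySeq := CauchySeq {
  cauchy_fun :> nat -> rat;
  cauchy_funP : cauchy_fun \in padic_cauchy p_pr }.

HB.instance Definition _ := [isSub for cauchy_fun].
HB.instance Definition _ := [Choice of cauchySeq by <:].
HB.instance Definition _ := [SubChoice_isSubComNzRing of cauchySeq by <:].

Definition padic_null : {pred cauchySeq} :=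
  fun x => `[< forall e : rat, 0 < e -> exists N, forall n,
    (N <= n)%N -> norm (x n) < e >].

Lemma padic_nullP (x : cauchySeq) : reflect
  (forall e : rat, 0 < e -> exists N, forall n, (N <= n)%N -> norm (x n) < e)
  (x \in padic_null).
Proof. exact: asboolP. Qed.

Lemma cauchyD (x y : cauchySeq) n : (x + y) n = x n + y n. Proof. by []. Qed.
Lemma cauchyN (x : cauchySeq) n : (- x) n = - x n. Proof. by []. Qed.
Lemma cauchyM (x y : cauchySeq) n : (x * y) n = x n * y n. Proof. by []. Qed.
Lemma cauchy1 n : (1 : cauchySeq) n = 1. Proof. by []. Qed.
Lemma cauchy0 n : (0 : cauchySeq) n = 0. Proof. by []. Qed.

Lemma padic_null_ideal : idealr_closed padic_null.
Proof.
split.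
- by apply/padic_nullP => e e0; exists 0 => n _; rewrite padic_norm0.
- apply/negP => /padic_nullP /(_ 1 ltr01)[N /(_ N (leqnn _))].
  by rewrite padic_norm1// ltxx.
- move=> a u v /padic_nullP hu /padic_nullP hv; apply/padic_nullP => e e0.
  have [M M0 [K hK]] := padic_cauchy_bounded (cauchy_funP a).
  have [N hN] := hu (e / M) (divr_gt0 e0 M0).
  have [N' hN'] := hv e e0.
  exists (maxn K (maxn N N')) => n; rewrite !geq_max => /and3P[n1 n2 n3].
  rewrite cauchyD cauchyM; apply: padic_norm_lt => //; last exact: hN'.
  rewrite padic_normM// -[e](divfK (lt0r_neq0 M0)) mulrC.
  by apply: ltr_pM; rewrite ?padic_norm_ge0// ?hN ?hK.
Qed.

HB.instance Definition _ := isIdealr.Build cauchySeq padic_null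
  padic_null_ideal.

End Cauchy.

Definition Qp (p : nat) (p_pr : prime p) := {ideal_quot (@padic_null p p_pr)}.
HB.instance Definition _ p (p_pr : prime p) := GRing.ComNzRing.on (Qp p_pr).

Section QpField.
Variables (p : nat) (p_pr : prime p).
Local Notation norm := (padic_norm p).
Local Notation K := (Qp p_pr).
Local Notation seqs := (cauchySeq p_pr).

Definition Qp_of (c : seqs) : K := \pi_{ideal_quot (@padic_null p p_pr)}%qT c.

Lemma Qp_of_repr (x : K) : Qp_of (repr x) = x. Proof. exact: reprK. Qed.

Lemma Qp_ofD c d : Qp_of (c + d) = Qp_of c + Qp_of d.
Proof. exact: rmorphD. Qed.

Lemma Qp_ofN c : Qp_of (- c) = - Qp_of c. Proof. exact: rmorphN. Qed.

Lemma Qp_ofB c d : Qp_of (c - d) = Qp_of c - Qp_of d.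
Proof. exact: rmorphB. Qed.

Lemma Qp_ofM c d : Qp_of (c * d) = Qp_of c * Qp_of d.
Proof. exact: rmorphM. Qed.

Lemma Qp_of1 : Qp_of 1 = 1. Proof. exact: rmorph1. Qed.

Lemma Qp_of0 : Qp_of 0 = 0. Proof. exact: rmorph0. Qed.

Lemma Qp_of_eq c d : (Qp_of c == Qp_of d) = (c - d \in @padic_null p p_pr).
Proof. by rewrite Quotient.idealrBE. Qed.

Lemma Qp_of_eq0 c : (Qp_of c == 0) = (c \in @padic_null p p_pr).
Proof. by rewrite -Qp_of0 Qp_of_eq subr0. Qed.

Lemma padic_norm_stationary c : c \notin @padic_null p p_pr ->
  exists N, norm (c N) != 0 /\ forall n, (N <= n)%N -> norm (c n) = norm (c N).
Proof.
move=> /asboolPn/existsNP[e /not_implyP[e0 /forallNP h]].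
have /padic_cauchyP/(_ e e0)[N hN] := cauchy_funP c.
have := h N => /existsNP[m /not_implyP[Nm /negP]]; rewrite -leNgt => em.
have E n : (N <= n)%N -> norm (c n) = norm (c m).
  by move=> Nn; apply: padic_norm_dom => //; apply: lt_le_trans em; exact: hN.
exists N; rewrite (E N)//; split; first by rewrite gt_eqF// (lt_le_trans e0).
by [].
Qed.

Lemma Qp_exists_inv (x : K) : x != 0 -> exists y, y * x = 1.
Proof.
rewrite -(Qp_of_repr x); set c := repr x; rewrite Qp_of_eq0 => c0.
have [N [rN0 rN]] := padic_norm_stationary c0; set r := norm (c N) in rN0 rN.
have r0 : 0 < r by rewrite lt_neqAle eq_sym rN0 padic_norm_ge0.
have cn0 n : (N <= n)%N -> c n != 0.
  by move=> Nn; rewrite -(padic_norm_eq0 p_pr) rN.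
have cd : (fun n => (c n)^-1) \in padic_cauchy p_pr.
  apply/padic_cauchyP => e e0.
  have /padic_cauchyP/(_ (e * (r * r)))[|M hM] := cauchy_funP c.
    by rewrite !mulr_gt0.
  exists (maxn N M) => m n; rewrite !geq_max => /andP[m1 m2] /andP[n1 n2].
  have -> : (c m)^-1 - (c n)^-1 = (c n - c m) / (c m * c n).
    by field; rewrite !cn0.
  rewrite padic_normM// padic_normV// padic_normM// !rN//.
  by rewrite ltr_pdivrMr ?mulr_gt0// hM.
exists (Qp_of (CauchySeq cd)); rewrite -Qp_ofM -Qp_of1.
apply/eqP; rewrite Qp_of_eq; apply/padic_nullP => e e0; exists N => n Nn.
by rewrite cauchyD cauchyN cauchyM cauchy1 /= mulVf ?cn0// subrr padic_norm0.
Qed.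

Definition Qp_inv (x : K) : K := xget 0 [set y | y * x = 1].

Lemma Qp_mulVf (x : K) : x != 0 -> Qp_inv x * x = 1.
Proof. by move=> /Qp_exists_inv; exact: xgetPex. Qed.

Lemma Qp_inv0 : Qp_inv 0 = 0.
Proof.
by apply: xgetPN => y /= /eqP; rewrite mulr0 eq_sym oner_eq0.
Qed.

HB.instance Definition _ := GRing.ComNzRing_isField.Build K Qp_mulVf Qp_inv0.

(* The p-adic norm extended to the completion by continuity. *)
Definition padic_norm_lim (c : seqs) : set rat :=
  [set r | forall e : rat, 0 < e -> exists N, forall n, (N <= n)%N ->
     `|norm (c n) - r| < e].

Definition Qp_norm (x : K) : rat := xget 0 (padic_norm_lim (repr x)).

Lemma padic_norm_lim_unique c r s :
  padic_norm_lim c r -> padic_norm_lim c s -> r = s.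
Proof.
move=> hr hs; apply/eqP; rewrite -subr_eq0 -normr_eq0; apply/negPn/negP => rs.
have e0 : 0 < `|r - s| / 2 by rewrite divr_gt0// lt_neqAle eq_sym rs normr_ge0.
have [N hN] := hr _ e0; have [M hM] := hs _ e0.
have := ltrD (hN _ (leq_maxl N M)) (hM _ (leq_maxr N M)).
rewrite -splitr distrC; set a := norm _ => lt.
by have := le_lt_trans (ler_normD (r - a) (a - s)) lt; rewrite addrA subrK ltxx.
Qed.

Lemma padic_norm_lim_eq c d r : Qp_of c = Qp_of d ->
  padic_norm_lim c r -> padic_norm_lim d r.
Proof.
move=> /eqP cd hr e e0.
have [c0|c0] := boolP (c \in @padic_null p p_pr).
  have r0 : padic_norm_lim c 0.
    move=> f f0; have /padic_nullP/(_ f f0)[N hN] := c0.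
    by exists N => n Nn; rewrite subr0 ger0_norm ?padic_norm_ge0// hN.
  rewrite (padic_norm_lim_unique hr r0).
  move: c0; rewrite -Qp_of_eq0 (eqP cd) Qp_of_eq0 => /padic_nullP/(_ e e0)[N hN].
  by exists N => n Nn; rewrite subr0 ger0_norm ?padic_norm_ge0// hN.
have [N [rN0 rN]] := padic_norm_stationary c0.
have [M hM] := hr e e0.
move: cd; rewrite eq_sym Qp_of_eq => /padic_nullP/(_ (norm (c N)))[|L hL].
  by rewrite lt_neqAle eq_sym rN0 padic_norm_ge0.
exists (maxn N (maxn M L)) => n; rewrite !geq_max => /and3P[n1 n2 n3].
rewrite (_ : norm (d n) = norm (c n)) ?hM//.
by apply: padic_norm_dom => //; rewrite (rN n)// -cauchyN -cauchyD hL.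
Qed.

Lemma Qp_norm_limE c r : padic_norm_lim c r -> Qp_norm (Qp_of c) = r.
Proof.
move=> hr; have hs : padic_norm_lim (repr (Qp_of c)) r.
  by apply: padic_norm_lim_eq hr; rewrite Qp_of_repr.
by apply: xget_unique => // s /padic_norm_lim_unique; apply.
Qed.

Lemma Qp_norm_null c : c \in @padic_null p p_pr -> Qp_norm (Qp_of c) = 0.
Proof.
move=> c0; apply: Qp_norm_limE => e e0; have /padic_nullP/(_ e e0)[N hN] := c0.
by exists N => n Nn; rewrite subr0 ger0_norm ?padic_norm_ge0// hN.
Qed.

Lemma Qp_norm_stationary c : c \notin @padic_null p p_pr ->
  Qp_norm (Qp_of c) != 0 /\
  exists N, forall n, (N <= n)%N -> norm (c n) = Qp_norm (Qp_of c).
Proof.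
move=> /padic_norm_stationary[N [rN0 rN]].
have -> : Qp_norm (Qp_of c) = norm (c N).
  by apply: Qp_norm_limE => e e0; exists N => n Nn; rewrite rN// subrr normr0.
by split=> //; exists N.
Qed.

Lemma Qp_norm0 : Qp_norm 0 = 0.
Proof. by rewrite -Qp_of0 Qp_norm_null// -Qp_of_eq0 Qp_of0. Qed.

Lemma Qp_norm_eq0 x : (Qp_norm x == 0) = (x == 0).
Proof.
rewrite -(Qp_of_repr x); have [c0|c0] := boolP (repr x \in @padic_null p p_pr).
  by rewrite Qp_norm_null// Qp_of_eq0 c0 eqxx.
by have [/negPf-> _] := Qp_norm_stationary c0; rewrite Qp_of_eq0 (negPf c0).
Qed.

Lemma Qp_norm_ge0 x : 0 <= Qp_norm x.
Proof.
rewrite -(Qp_of_repr x); have [c0|c0] := boolP (repr x \in @padic_null p p_pr).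
  by rewrite Qp_norm_null.
by have [_ [N /(_ N (leqnn N))<-]] := Qp_norm_stationary c0; exact: padic_norm_ge0.
Qed.

Lemma Qp_norm_ltP c e : 0 < e -> (Qp_norm (Qp_of c) < e) <->
  exists N, forall n, (N <= n)%N -> norm (c n) < e.
Proof.
move=> e0; have [c0|c0] := boolP (c \in @padic_null p p_pr).
  by rewrite Qp_norm_null// e0; split=> // _; move/padic_nullP: c0; exact.
have [_ [N hN]] := Qp_norm_stationary c0; split=> [lt|[M hM]].
  by exists N => n Nn; rewrite hN.
by rewrite -(hN (maxn N M)) ?leq_maxl// hM ?leq_maxr.
Qed.

Lemma Qp_norm_le_lt x y e : Qp_norm x < e -> Qp_norm y < e ->
  Qp_norm (x + y) < e.
Proof.
move=> hx hy; have e0 : 0 < e by exact: le_lt_trans (Qp_norm_ge0 x) hx.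
move: hx hy; rewrite -(Qp_of_repr x) -(Qp_of_repr y) -Qp_ofD.
move=> /(Qp_norm_ltP _ e0)[N hN] /(Qp_norm_ltP _ e0)[M hM].
apply/(Qp_norm_ltP _ e0); exists (maxn N M) => n.
by rewrite geq_max => /andP[n1 n2]; apply: padic_norm_lt; rewrite ?hN ?hM.
Qed.

Lemma Qp_normD x y : Qp_norm (x + y) <= Num.max (Qp_norm x) (Qp_norm y).
Proof.
rewrite leNgt gt_max; apply/negP => /andP[hx hy].
by have := Qp_norm_le_lt hx hy; rewrite ltxx.
Qed.

Lemma Qp_normM x y : Qp_norm (x * y) = Qp_norm x * Qp_norm y.
Proof.
have [->|x0] := eqVneq x 0; first by rewrite mul0r Qp_norm0 mul0r.
have [->|y0] := eqVneq y 0; first by rewrite mulr0 Qp_norm0 mulr0.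
have xy0 : x * y != 0 by rewrite mulf_neq0.
move: x0 y0 xy0; rewrite -(Qp_of_repr x) -(Qp_of_repr y) -Qp_ofM !Qp_of_eq0.
move=> /Qp_norm_stationary[_ [N hN]] /Qp_norm_stationary[_ [M hM]].
move=> /Qp_norm_stationary[_ [L hL]].
pose n := maxn N (maxn M L).
rewrite -(hN n) ?leq_maxl// -(hM n) ?leq_max ?leqnn ?orbT//.
by rewrite -(hL n) ?leq_max ?leqnn ?orbT// cauchyM padic_normM.
Qed.

Lemma Qp_normN x : Qp_norm (- x) = Qp_norm x.
Proof.
rewrite -mulN1r Qp_normM; suff -> : Qp_norm (-1) = 1 by rewrite mul1r.
rewrite -Qp_of1 -Qp_ofN; apply: Qp_norm_limE => e e0; exists 0 => n _.
by rewrite cauchyN padic_normN cauchy1 padic_norm1// subrr normr0.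
Qed.

Definition Qp_dist (x y : K) : rat := Qp_norm (x - y).

Lemma Qp_distxx x : Qp_dist x x = 0.
Proof. by rewrite /Qp_dist subrr Qp_norm0. Qed.

Lemma Qp_dist_eq0 x y : Qp_dist x y = 0 -> x = y.
Proof. by move/eqP; rewrite Qp_norm_eq0 subr_eq0 => /eqP. Qed.

Lemma Qp_dist_sym x y : Qp_dist x y = Qp_dist y x.
Proof. by rewrite /Qp_dist -Qp_normN opprB. Qed.

Lemma Qp_dist_triangle y x z : Qp_dist x z <= Qp_dist x y + Qp_dist y z.
Proof.
rewrite /Qp_dist -(subrK y x) -addrA [in leRHS]addrK.
apply: le_trans (Qp_normD _ _) _.
by rewrite ge_max lerDl lerDr !Qp_norm_ge0.
Qed.

HB.instance Definition _ := isMetric.Build rat K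
  Qp_distxx Qp_dist_eq0 Qp_dist_sym Qp_dist_triangle.

End QpField.

Section QpRat.
Variables (p : nat) (p_pr : prime p).
Local Notation norm := (padic_norm p).
Local Notation K := (Qp p_pr).

Lemma const_padic_cauchy (q : rat) : (fun=> q) \in padic_cauchy p_pr.
Proof.
by apply/padic_cauchyP => e e0; exists 0 => m n _ _; rewrite subrr padic_norm0.
Qed.

Definition const_seq (q : rat) : cauchySeq p_pr :=
  CauchySeq (const_padic_cauchy q).

Lemma const_seqM q r : const_seq (q * r) = const_seq q * const_seq r.
Proof. exact/val_inj. Qed.

Lemma Qp_norm_const q : Qp_norm (Qp_of (const_seq q)) = norm q.
Proof.
by apply: Qp_norm_limE => e e0; exists 0 => n _; rewrite subrr normr0.
Qed.

Lemma Qp_of_nat (n : nat) : Qp_of (const_seq n%:R) = n%:R :> K.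
Proof.
elim: n => [|n IH].
  by rewrite -[RHS](Qp_of0 p_pr); congr Qp_of; exact/val_inj.
rewrite -[n.+1]addn1 [in RHS]natrD -IH -(Qp_of1 p_pr) -Qp_ofD.
by congr Qp_of; apply/val_inj/funext => m /=; rewrite natrD.
Qed.

Lemma Qp_of_int (z : int) : Qp_of (const_seq z%:~R) = z%:~R :> K.
Proof.
case: z => n; first exact: Qp_of_nat.
rewrite NegzE !mulrNz -!pmulrn -Qp_of_nat -Qp_ofN.
by congr Qp_of; exact/val_inj.
Qed.

Lemma Qp_of_ratr (q : rat) : Qp_of (const_seq q) = ratr q :> K.
Proof.
have d0 : (denq q)%:~R != 0 :> K.
  by rewrite -Qp_of_int -Qp_norm_eq0 Qp_norm_const padic_norm_eq0// intr_eq0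
    denq_neq0.
apply: (mulIf d0); rewrite /ratr divfK// -!Qp_of_int -Qp_ofM -const_seqM.
by rewrite numqE.
Qed.

Lemma Qp_norm_ratr (q : rat) : Qp_norm (ratr q : K) = norm q.
Proof. by rewrite -Qp_of_ratr Qp_norm_const. Qed.

Lemma Qp_rat_approx (x : K) (e : rat) : 0 < e ->
  exists q, mdist x (ratr q : K) < e.
Proof.
move=> e0; rewrite -(Qp_of_repr x); set c := repr x.
have /padic_cauchyP/(_ e e0)[N hN] := cauchy_funP c.
exists (c N); rewrite -Qp_of_ratr.
change (Qp_norm (Qp_of c - Qp_of (const_seq (c N))) < e).
by rewrite -Qp_ofB; apply/(Qp_norm_ltP _ e0); exists N => n Nn; exact: hN.
Qed.

Lemma Qp_complete (u : nat -> K) :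
  (forall e : rat, 0 < e -> exists N, forall m n,
    (N <= m)%N -> (N <= n)%N -> mdist (u m) (u n) < e) ->
  exists l, forall e : rat, 0 < e -> exists N, forall n,
    (N <= n)%N -> mdist (u n) l < e.
Proof.
move=> hu.
have /choice[q hq] : forall n, exists r, mdist (u n) (ratr r : K) < n.+1%:R^-1.
  by move=> n; apply: Qp_rat_approx; rewrite invr_gt0 ltr0n.
have small (e : rat) : 0 < e -> exists N, forall n, (N <= n)%N ->
    mdist (u n) (ratr (q n) : K) < e.
  move=> e0; exists (Num.bound e^-1) => n Nn; apply: lt_le_trans (hq n) _.
  rewrite invf_ple ?posrE ?ltr0n//; apply/ltW.
  apply: lt_le_trans (archi_boundP _) _; first by rewrite invr_ge0 ltW.
  by rewrite ler_nat leqW.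
have tri (x y z : K) (e : rat) :
    mdist x y < e -> mdist y z < e -> mdist x z < e.
  move=> xy yz; change (Qp_norm (x - z : K) < e).
  by rewrite -(subrK y x) -addrA; exact: Qp_norm_le_lt.
have cq : q \in padic_cauchy p_pr.
  apply/padic_cauchyP => e e0.
  have [N hN] := small e e0; have [M hM] := hu e e0.
  exists (maxn N M) => m n; rewrite !geq_max => /andP[m1 m2] /andP[n1 n2].
  have <- : Qp_norm (ratr (q m) - ratr (q n) : K) = norm (q m - q n).
    by rewrite -!Qp_of_ratr -Qp_ofB -Qp_norm_const; congr (Qp_norm (Qp_of _));
      exact/val_inj.
  change (mdist (ratr (q m) : K) (ratr (q n)) < e).
  apply: (tri _ (u m)); first by rewrite metric_sym hN.
  by apply: (tri _ (u n)); rewrite ?hM ?hN.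
exists (Qp_of (CauchySeq cq)) => e e0.
have [N hN] := small e e0; have /padic_cauchyP/(_ e e0)[M hM] := cq.
exists (maxn N M) => n; rewrite geq_max => /andP[n1 n2].
apply: (tri _ (ratr (q n))); first exact: hN.
rewrite -Qp_of_ratr.
change (Qp_norm (Qp_of (const_seq (q n)) - Qp_of (CauchySeq cq)) < e).
by rewrite -Qp_ofB; apply/(Qp_norm_ltP _ e0); exists M => m Mm; exact: hM.
Qed.

End QpRat.

Definition ratio_set (A : set int) : set rat :=
  [set q | exists a b : int, [/\ A a, A b, b != 0 & q = a%:~R / b%:~R]].

(* Main.v *)
(** For [n >= 1] the sequence is [u n = F_{2n}], i.e. [u 0 = 0], [u 1 = 1] and
    [u (n+2) = 3 u (n+1) - u n].  This recurrence is invertible modulo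
    [N = p ^ r], so it is purely periodic there: some [k > 0] has [u k = 0] and
    [u (k+1) = 1] modulo [N].  With [V = 2 u (k+1) - 3 u k] one has
    [u (k (n+2)) = V u (k (n+1)) - u (k n)] and [V = 2] modulo [N], whence
    [u (k n) = u k * w] with [w = n] modulo [N].  Thus [u (k n) / u (k m)] is
    [p]-adically close to [n / m]. *)

Require Import Defs.
From mathcomp Require Import all_boot all_order all_algebra.
From mathcomp Require Import ring zify.
From mathcomp Require Import boolp classical_sets functions topology.

Set Implicit Arguments.
Unset Strict Implicit.
Unset Printing Implicit Defensive.

Import Order.TTheory GRing.Theory Num.Theory.
Local Open Scope classical_set_scope.
Local Open Scope ring_scope.

(** * Identities for the even-indexed Fibonacci numbers *)

Fixpoint fib2 (n : nat) : int :=
  if n is m.+1 then (if m is l.+1 then 3 * fib2 m - fib2 l else 1) else 0.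

Lemma fib2SS n : fib2 n.+2 = 3 * fib2 n.+1 - fib2 n.
Proof. by []. Qed.

Lemma fib2_lt n : 0 <= fib2 n < fib2 n.+1.
Proof. by elim: n => [|n IHn] //; rewrite fib2SS; lia. Qed.

Lemma fib2_neq0 n : (0 < n)%N -> fib2 n != 0.
Proof. by case: n => // n _; have := fib2_lt n; lia. Qed.

Lemma fib2D m n :
  fib2 (m + n).+1 = fib2 m.+1 * fib2 n.+1 - fib2 m * fib2 n.
Proof.
suff: fib2 (m + n).+1 = fib2 m.+1 * fib2 n.+1 - fib2 m * fib2 n /\
      fib2 (m + n).+2 = fib2 m.+2 * fib2 n.+1 - fib2 m.+1 * fib2 n by case.
elim: m => [|m [IH1 IH2]].
  by rewrite !add0n !fib2SS /=; split; ring.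
split; first exact: IH2.
by rewrite addSn fib2SS IH2 IH1 !fib2SS; ring.
Qed.

(** The form [b^2 - 3ab + a^2] is invariant under the shift [(a, b) -> (b, 3b - a)]. *)
Lemma fib2_cassini n :
  fib2 n.+1 ^+ 2 - 3 * fib2 n.+1 * fib2 n + fib2 n ^+ 2 = 1.
Proof. by elim: n => [|n IHn] //; rewrite -[RHS]IHn fib2SS; ring. Qed.

(** Cayley-Hamilton for the [k]-th power of the companion matrix: the determinant is 1 and the trace
    is [fib2 k.+1 - fib2 k.-1], that is [2 * fib2 k.+1 - 3 * fib2 k]. *)
Lemma fib2_step k n :
  fib2 (n + k + k) = (2 * fib2 k.+1 - 3 * fib2 k) * fib2 (n + k) - fib2 n.
Proof.
have C := fib2_cassini k.
(* Eliminating the predecessor of [l] from the addition formula keeps it valid at [l = 0]. *)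
have D l : fib2 (l + k) = fib2 l * fib2 k.+1 - 3 * (fib2 l * fib2 k)
             + fib2 l.+1 * fib2 k.
  case: l => [|l]; first by rewrite add0n /=; ring.
  by rewrite addSn fib2D fib2SS; ring.
rewrite D fib2D D.
set a := fib2 k in C *; set b := fib2 k.+1 in C *.
(* The Cassini form replaces a factor 1 of [fib2 n], which makes the identity polynomial. *)
by rewrite -[X in _ = _ - X]mulr1 -[X in _ = _ - _ * X]C; ring.
Qed.

(** * Periodicity modulo [N] and multiples of a period *)

Lemma fib2_period (N : nat) : (1 < N)%N ->
  exists2 k, (0 < k)%N & (N%:Z %| fib2 k)%Z /\ (N%:Z %| fib2 k.+1 - 1)%Z.
Proof.
move=> N1.
have dvdN (z : int) : z%:~R = 0 :> 'Z_N -> (N%:Z %| z)%Z.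
  have natN m : m%:R = 0 :> 'Z_N -> (N %| m)%N.
    by move=> m0; rewrite /dvdn -(val_Zp_nat N1) m0.
  case: z => m; first exact: natN.
  by rewrite NegzE mulrNz dvdzE abszN => /eqP; rewrite oppr_eq0 => /eqP /natN.
pose f (s : 'Z_N * 'Z_N) := (s.2, 3%:R * s.2 - s.1).
have f_inj : injective f.
  move=> [a b] [c d] e; have /= -> := congr1 fst e.
  by have /= := congr1 snd e; have /= -> := congr1 fst e; move/addrI/oppr_inj => ->.
have fE n : iter n f (0, 1) = ((fib2 n)%:~R, (fib2 n.+1)%:~R).
  by elim: n => [|n IHn] //; rewrite iterS IHn /f fib2SS intrB intrM.
exists (order f (0, 1)); first exact: order_gt0.
have := iter_order f_inj (0, 1); rewrite fE => -[e0 e1].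
by split; apply: dvdN => //; rewrite intrB e1 subrr.
Qed.

Lemma fib2_multiples (N : nat) : (1 < N)%N ->
  exists2 k, (0 < k)%N & forall n, exists2 w : int,
    fib2 (n * k) = fib2 k * w & (N%:Z %| w - n%:Z)%Z.
Proof.
move=> /fib2_period[k k0 [/dvdzP[c ec] /dvdzP[d ed]]]; exists k => // n.
suff: (exists2 w : int, fib2 (n * k) = fib2 k * w & (N%:Z %| w - n%:Z)%Z) /\
  (exists2 w : int, fib2 (n.+1 * k) = fib2 k * w & (N%:Z %| w - n.+1%:Z)%Z).
  by case.
elim: n => [|n [[w ew /dvdzP[s es]] [w' ew' /dvdzP[t et]]]].
  split; first by exists 0; rewrite ?mul0n ?mulr0 ?subrr.
  by exists 1; rewrite ?mul1n ?mulr1 ?subrr.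
split; first by exists w'; rewrite // et dvdz_mull.
exists ((2 * fib2 k.+1 - 3 * fib2 k) * w' - w).
  by rewrite !mulSn addnC [(k + n * k)%N]addnC fib2_step [(n * k + k)%N]addnC -mulSn
    ew ew'; ring.
(* With [V = 2 * fib2 k.+1 - 3 * fib2 k] one has [V - 2 = (2d - 3c)N]; split [V w' - w - (n+2)] as
   [(V - 2) w' + 2 (w' - (n+1)) - (w - n)]. *)
apply/dvdzP; exists ((2 * d - 3 * c) * w' + 2 * t - s).
have -> : fib2 k.+1 = d * N%:Z + 1 by rewrite -ed subrK.
have -> : w = s * N%:Z + n%:Z by rewrite -es subrK.
have -> : n.+2%:Z = 2 * n.+1%:Z - n%:Z by lia.
rewrite {}ec; apply/eqP; rewrite -subr_eq0; apply/eqP.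
by rewrite -[RHS](mulr0 2) -(subrr (w' - n.+1%:Z)) {2}et; ring.
Qed.

(** * p-adic estimates and approximation of rationals *)

Lemma padic_norm_int_le1 (p : nat) (p_pr : prime p) (z : int) :
  padic_norm p z%:~R <= 1.
Proof.
rewrite /padic_norm; case: eqP => // _.
rewrite /padic_val numq_int denq_int logn1 subr0 -exprnN.
by rewrite invf_le1 ?exprn_gt0 ?exprn_ege1 ?ltr0n ?ler1n ?prime_gt0.
Qed.

Lemma padic_norm_dvd (p : nat) (p_pr : prime p) (r : nat) (z : int) :
  ((p ^ r)%N%:Z %| z)%Z -> padic_norm p z%:~R <= p%:R ^- r.
Proof.
move=> /dvdzP[c ->]; rewrite intrM padic_normM//.
have -> : padic_norm p (p ^ r)%N%:~R = p%:R ^- r.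
  rewrite /padic_norm intr_eq0 eqz_nat expn_eq0 gtn_eqF ?(prime_gt0 p_pr)//=.
  by rewrite /padic_val numq_int denq_int logn1 subr0 pfactorK// exprnN.
by rewrite ler_piMl ?padic_norm_int_le1// invr_ge0 exprn_ge0// ler0n.
Qed.

Lemma padic_pow_small (p : nat) (p_pr : prime p) (e : rat) : 0 < e ->
  exists2 r, (0 < r)%N & p%:R ^- r < e.
Proof.
move=> e0; pose b := Num.bound e^-1; exists b.+1 => //.
rewrite invf_plt ?posrE ?exprn_gt0 ?ltr0n ?prime_gt0//.
apply: lt_trans (archi_boundP _) _; first by rewrite invr_ge0 ltW.
by rewrite -natrX ltr_nat (leq_trans (ltnSn _))// ltnW// ltn_expl ?prime_gt1.
Qed.

Lemma fib2_ratio_approx (p : nat) (p_pr : prime p) (q e : rat) : 0 < e ->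
  exists m n : nat, [/\ (0 < m)%N, (0 < n)%N &
    padic_norm p (q - (fib2 m)%:~R / (fib2 n)%:~R) < e].
Proof.
move=> e0; pose a := numq q; pose d := `|denq q|%N.
have d0 : (0 < d)%N by rewrite absz_gt0 denq_neq0.
have d0' : d%:R != 0 :> rat by rewrite pnatr_eq0 -lt0n.
have qE : q = a%:~R / d%:R.
  by rewrite -[LHS]divq_num_den /d natr_absz gtr0_norm ?denq_gt0.
have nd0 : 0 < padic_norm p d%:R.
  by rewrite lt_neqAle eq_sym padic_norm_eq0// d0' padic_norm_ge0.
(* The first bound forces [v] to have the norm of [d]; the second absorbs the denominator [d v] of
   the error, whose norm is then that of [d] squared. *)
have [|r r0] := @padic_pow_small p p_pr
  (Num.min (padic_norm p d%:R) (e * padic_norm p d%:R ^+ 2)).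
  by rewrite lt_min nd0 mulr_gt0 ?exprn_gt0.
rewrite lt_min => /andP[rd re].
have N1 : (1 < p ^ r)%N by rewrite -{1}(exp1n r) ltn_exp2r ?prime_gt1.
(* [a] may be negative or zero, so it is replaced by a positive [n] congruent to it; adding [N]
   excludes 0. *)
pose N := (p ^ r)%N; pose n := (`|(a %% N%:Z)%Z| + N)%N.
have n0 : (0 < n)%N by rewrite addn_gt0 (ltnW N1) orbT.
have [k k0 hk] := fib2_multiples N1.
have [w ew nw] := hk n; have [v ev dv] := hk d.
have aw : ((p ^ r)%N%:Z %| w - a)%Z.
  have -> : w - a = (w - n%:Z) + (n%:Z - a) by ring.
  rewrite rpredD//; apply/dvdzP; exists (1 - (a %/ N%:Z)%Z).
  rewrite /n PoszD gez0_abs ?modz_ge0//; last by rewrite -lt0n ltnW.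
  by rewrite {2}(divz_eq a N%:Z); ring.
have vd : padic_norm p v%:~R = padic_norm p d%:R.
  apply: (padic_norm_dom p_pr); apply: le_lt_trans rd.
  by rewrite -[d%:R]/(d%:Z%:~R) -intrB padic_norm_dvd.
have v0 : v%:~R != 0 :> rat by rewrite -(padic_norm_eq0 p_pr) vd gt_eqF.
have u0 : (fib2 k)%:~R != 0 :> rat by rewrite intr_eq0 fib2_neq0.
exists (n * k)%N, (d * k)%N; split; rewrite ?muln_gt0 ?n0 ?d0//.
rewrite ew ev !intrM -mulf_div divff// mul1r qE.
(* Written this way, the numerator is visibly divisible by [p ^ r]. *)
have -> : a%:~R / d%:R - w%:~R / v%:~R =
    (a * (v - d%:Z) - d%:Z * (w - a))%:~R / (d%:R * v%:~R) :> rat.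
  rewrite !(intrB, intrM) -[d%:Z%:~R]/(d%:R); field.
  by rewrite d0' v0.
rewrite padic_normM// padic_normV// padic_normM// vd -expr2.
rewrite ltr_pdivrMr ?exprn_gt0//; apply: le_lt_trans re.
by rewrite padic_norm_dvd// rpredB// dvdz_mull.
Qed.

(** * From the convolution recurrence to density *)

Lemma convolution_fib2 (x : nat -> int) :
  x 0%N = 1 ->
  (forall n : nat, (1 <= n)%N ->
     x n = \sum_(1 <= i < n.+1) i%:Z * x (n - i)%N) ->
  forall n, (0 < n)%N -> x n = fib2 n.
Proof.
move=> x0 xS; pose S n := \sum_(0 <= i < n.+1) x (n - i)%N.
have SS n : S n.+1 = x n.+1 + S n.
  by rewrite /S big_nat_recl// subn0.
have xE n : (0 < n)%N -> x n = \sum_(0 <= i < n.+1) i%:Z * x (n - i)%N.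
  by move=> n0; rewrite xS// [RHS]big_nat_recl// mul0r add0r big_add1.
(* Lowering every weight by one leaves the convolution for [n.+1] plus a plain sum of terms. *)
have xSS n : x n.+2 = x n.+1 + S n.+1.
  rewrite xS// big_add1 /= [in X in _ = X + _]xE// /S -big_split /=.
  by apply: eq_bigr => i _; rewrite subSS intS; ring.
have x1 : x 1%N = 1 by rewrite xS// big_nat1 mul1r.
have x2 : x 2%N = 3 by rewrite xSS x1 /S !big_nat_recl// big_geq//= x0 x1.
(* The induction starts at index 1, since [x 0 = 1] while [fib2 0 = 0]. *)
suff E n : x n.+1 = fib2 n.+1 /\ x n.+2 = fib2 n.+2 by case=> // n _; case: (E n).
elim: n => [|n [IH1 IH2]]; first by rewrite x1 x2.
split=> //; rewrite xSS SS fib2SS -IH2 -IH1.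
by have := xSS n; lia.
Qed.

(** Rationals are dense in the completion, and the ultrametric inequality chains two approximations
    without enlarging [e]. *)
Lemma dense_Qp (p : nat) (p_pr : prime p) (A : set rat) :
  (forall q e : rat, 0 < e -> exists2 s, A s & padic_norm p (q - s) < e) ->
  dense ((fun q : rat => ratr q : Qp p_pr) @` A).
Proof.
move=> hA O [y Oy] oO.
have /nbhs_ballP[e /= e0 ye] : nbhs y O by exact: open_nbhs_nbhs.
have [q yq] := Qp_rat_approx y e0.
have [s As qs] := hA q e e0.
exists (ratr s); split; last by exists s.
apply: ye; rewrite ballEmdist /=.
change (Qp_norm (y - ratr s : Qp p_pr) < e).
rewrite -(subrK (ratr q) y) -addrA; apply: Qp_norm_le_lt => //.
rewrite -!Qp_of_ratr -Qp_ofB.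
rewrite (_ : _ - _ = const_seq p_pr (q - s)) ?Qp_norm_const//.
exact/val_inj.
Qed.

Theorem theorem1p5 (x : nat -> int)
  (x0 : x 0%N = 1)
  (xS : forall n : nat, (1 <= n)%N ->
     x n = \sum_(1 <= i < n.+1) i%:Z * x (n - i)%N)
  (p : nat) (p_pr : prime p) :
  dense ((fun q : rat => ratr q : Qp p_pr) @` ratio_set (range x)).
Proof.
apply: dense_Qp => q e e0.
have [m [n [m0 n0 mn]]] := fib2_ratio_approx p_pr q e0.
have xE := convolution_fib2 x0 xS.
exists ((fib2 m)%:~R / (fib2 n)%:~R) => //.
exists (fib2 m), (fib2 n); split=> //; last exact: fib2_neq0.
- by exists m; rewrite ?xE.
- by exists n; rewrite ?xE.
Qed.
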